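(* Let $H$ be a finite simple graph with $\Delta(H)\le 2$ and let $V_1,\dots,V_n$ be pairwise disjoint subsets of $V(H)$ with $|V_i|=4$ for every $i$. Then $(V_1,\dots,V_n)$ has two disjoint independent sets of representatives.
   Context: An independent set of representatives (ISR) of $(V_1,\dots,V_n)$ is an independent set $R$ of $H$ containing exactly one vertex from each $V_i$. *)

(* Defs.v *)
From mathcomp Require Import all_boot.
Set Implicit Arguments. Unset Strict Implicit. Unset Printing Implicit Defensive.

Definition simple_graph (T : finType) (e : rel T) : Prop :=
  symmetric e /\ irreflexive e.

Definition nbhd (T : finType) (e : rel T) (x : T) : {set T} := [set y | e x y].
Definition max_degree_le (T : finType) (e : rel T) (d : nat) : Prop :=
  forall x : T, #|nbhd e x| <= d.

Definition independent (T : finType) (e : rel T) (R : {set T}) : Prop :=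
  forall x y, x \in R -> y \in R -> ~~ e x y.

Definition is_ISR (T : finType) (e : rel T) (n : nat) (V : 'I_n -> {set T})
    (R : {set T}) : Prop :=
  independent e R /\ R \subset \bigcup_(i < n) V i /\
  forall i : 'I_n, #|R :&: V i| = 1.

(* Main.v *)
(* A graph in which every nonempty set of edges contains an edge xy (for that
   set) with |N(x) u N(y)| <= m has an ISR as soon as all parts have size >= m:
   deleting or exploding such edges, as in Meshulam's game, shows that the
   independence complex of an induced subgraph on W has no reduced homology in
   low dimension compared with |W| / m, and a Sperner argument concludes.
   This is used three times.  With m = 4, it gives an ISR of H, and a system S of
   vertices in distinct parts, one from each component of size >= 4 of the graph
   H[W] induced on the union W of the parts (an ISR with the components as parts
   and the V_i as cliques).  If an ISR R of H misses a component C, exchanging a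
   representative for the vertex of S in C keeps R independent and increases
   |R n S|; so some ISR R1 meets all components of size >= 4.  After removing R1,
   the components are paths and triangles, so m = 3 works, and the parts still
   have 3 vertices: this gives R2. *)
Require Import Defs.
From mathcomp Require Import all_boot.

Set Implicit Arguments.
Unset Strict Implicit.
Unset Printing Implicit Defensive.

(** * Sums over F_2 *)

Local Notation "\xor_ ( i | P ) F" := (\big[addb/false]_(i | P) F)
  (at level 41, F at level 41, i at level 50).
Local Notation "\xor_ ( i 'in' A ) F" := (\big[addb/false]_(i in A) F)
  (at level 41, F at level 41, i, A at level 50).

Lemma addb_eq a b : a (+) b = false -> a = b.
Proof. by case: a b => [] []. Qed.

Lemma xor_const (I : finType) (P : pred I) b :
  \xor_(i | P i) b = odd #|P| && b.
Proof.
case: b; rewrite ?andbT ?andbF; last by rewrite big1.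
by rewrite -sum1_card (big_morph odd oddD (erefl (odd 0))).
Qed.

(** Each unordered pair of distinct indices contributes twice and cancels; the ordering [r] splits
    the sum into two equal halves. *)
Lemma xor_sym0 (I : finType) (J : {set I}) (g : I -> I -> bool) :
  (forall i j, g i j = g j i) ->
  \xor_(i in J) \xor_(j in J :\ i) g i j = false.
Proof.
move=> gC; pose r (i j : I) := enum_rank i < enum_rank j.
transitivity ((\xor_(i in J) \xor_(j | (j \in J) && r i j) g i j) (+)
              (\xor_(i in J) \xor_(j | (j \in J) && r j i) g i j)).
  rewrite -big_split; apply: eq_bigr => i _ /=.
  rewrite (bigID (r i)) /=; congr (_ (+) _); apply: eq_bigl => j;
    rewrite !inE /r; case: (j \in J); rewrite ?andbF //= andbT;
    rewrite -(inj_eq enum_rank_inj) -(inj_eq val_inj) /=; by case: ltngtP.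
rewrite [X in _ (+) X](exchange_big_dep (mem J)) /=; last by move=> i j _ /andP[].
rewrite [X in _ (+) X](_ : _ =
  \xor_(i in J) \xor_(j | (j \in J) && r i j) g i j) ?addbb //.
apply: eq_bigr => i iJ; rewrite iJ /=; apply: eq_bigr => j _; exact: gC.
Qed.

(** * Chains over F_2 and acyclic independence complexes *)

Section Chains.
Variable T : finType.
Implicit Types (c w z : {set T} -> bool) (s t : {set T}) (x y : T).

(* Chains over F_2 of a simplicial complex on T are boolean functions on {set T};
   the empty set is a simplex, so homology is reduced. *)
Definition bdry c s := \xor_(x | x \notin s) c (x |: s).

Definition cone x c s := (x \in s) && c (s :\ x).

Lemma eq_bdry c w : c =1 w -> bdry c =1 bdry w.
Proof. by move=> cw s; apply: eq_bigr => x _; rewrite cw. Qed.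

Lemma eq_cone x c w : c =1 w -> cone x c =1 cone x w.
Proof. by move=> cw s; rewrite /cone cw. Qed.

Lemma bdryD c w s : bdry (fun t => c t (+) w t) s = bdry c s (+) bdry w s.
Proof. by rewrite /bdry big_split. Qed.

(** The Leibniz rule d(x c) = c + x d(c): a face of a coned simplex either drops the apex [x] or
    keeps it. *)
Lemma bdry_cone x c : (forall s, c s -> x \notin s) ->
  forall s, bdry (cone x c) s = c s (+) cone x (bdry c) s.
Proof.
move=> cx s; rewrite /bdry /cone; have [xs|xs] /= := boolP (x \in s).
  have -> : c s = false by apply: contraTF xs => /cx.
  rewrite [RHS](bigD1 x) /=; last by rewrite !inE eqxx.
  rewrite (_ : c (x |: _) = false) /=; last first.
    by apply: contraTF isT => /cx; rewrite !inE eqxx.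
  apply: eq_big => [y|y ys]; last first.
    rewrite inE xs orbT /= setDUl; congr (c (_ :|: _)).
    apply/setP=> v; rewrite !inE; case: (eqVneq v y) => [->|_]; rewrite ?andbF ?andbT //.
    by apply: contraNneq ys => ->.
  by rewrite !inE; case: (eqVneq y x) => [->|_]; rewrite ?xs ?andbT ?andbF.
rewrite addbF (bigD1 x) //= setU11 setU1K //= big1 ?addbF // => y /andP[_ yx].
by rewrite !inE (negPf xs) eq_sym (negPf yx).
Qed.

Definition indep (f : rel T) s := [forall x in s, forall y in s, ~~ f x y].

Lemma indepP (f : rel T) s : reflect (independent f s) (indep f s).
Proof.
apply: (iffP forall_inP) => [H x y xs ys|H x xs]; last first.
  by apply/forall_inP => y; apply: H.
exact: (forall_inP (H x xs)).
Qed.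

Definition supported (f : rel T) (W : {set T}) k c :=
  forall s, c s -> [/\ indep f s, s \subset W & #|s| = k].

(** Since [k] counts vertices, this is the vanishing, in dimension k - 1, of the reduced homology of
    the independence complex of [f] induced on [W]. *)
Definition acyclic (f : rel T) (W : {set T}) k :=
  forall z, supported f W k z -> bdry z =1 xpred0 ->
  exists2 w, supported f W k.+1 w & bdry w =1 z.

(** The cone from [x] over the part [z'] of [z] avoiding [x] has boundary z' + x d(z'), and the
    cycle condition makes x d(z') the part of [z] through [x]. *)
Lemma cone_fill f (W : {set T}) k z x : x \in W -> supported f W k z ->
  bdry z =1 xpred0 -> (forall s, z s -> indep f (x |: s)) ->
  exists2 w, supported f W k.+1 w & bdry w =1 z.
Proof.
move=> xW zs z0 zx; pose z' s := z s && (x \notin s).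
exists (cone x z') => [s /andP[xs /andP[zsx _]]|s].
  have [_ sW sk] := zs _ zsx; split; first by rewrite -(setD1K xs) zx.
    by rewrite -(setD1K xs) subUset sub1set xW.
  by rewrite (cardsD1 x) xs sk.
rewrite bdry_cone => [|t /andP[] //].
rewrite /cone /z'; have [xs|xs] /= := boolP (x \in s); last by rewrite addbF andbT.
rewrite andbF /=; have := z0 (s :\ x).
rewrite /bdry (bigD1 x) /=; last by rewrite !inE eqxx.
rewrite setD1K // => /addb_eq/= ->.
rewrite [LHS](bigD1 x) /=; last by rewrite !inE eqxx.
rewrite setU11 andbF /=; apply: eq_bigr => v /andP[_ vx].
by rewrite !inE eqxx eq_sym (negPf vx) andbT.
Qed.

Definition del_edge (f : rel T) x y : rel T :=
  fun a b => f a b && ~~ ((a == x) && (b == y) || (a == y) && (b == x)).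

(* The independent sets of f plus those of the form {x, y} u s, with s in
   W minus the neighborhoods of x and y, are the independent sets of f minus xy.
   A filling w of z for the latter is w0 + x y u with u a cycle; filling u by v
   and replacing x y u by x v + y v makes w independent for f. *)
Lemma explode f (W : {set T}) k x y : symmetric f -> irreflexive f -> f x y ->
  x \in W -> y \in W -> acyclic (del_edge f x y) W k.+1 ->
  acyclic (del_edge f x y) (W :\: (nbhd f x :|: nbhd f y)) k ->
  acyclic f W k.+1.
Proof.
move=> fC fI fxy xW yW aD aN z zs z0; set g := del_edge f x y in aD aN.
have xy : x != y by apply: contraTneq fxy => ->; rewrite fI.
have gf s : indep f s -> indep g s.
  by move=> /indepP H; apply/indepP => a b As Bs; rewrite /g /del_edge negb_and H.
have fg s : indep g s -> ~~ ((x \in s) && (y \in s)) -> indep f s.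
  move=> /indepP H nxy; apply/indepP => a b As Bs.
  have := H a b As Bs; rewrite /g /del_edge negb_and negbK => /orP[//|].
  by case/orP=> /andP[/eqP ab /eqP bb]; move: nxy; rewrite -ab -bb As Bs.
have [w ws wz] : exists2 w, supported g W k.+2 w & bdry w =1 z.
  by apply: aD => // s /zs[si sW sk]; split=> //; apply: gf.
have zxy s : x \in s -> y \in s -> z s = false.
  by move=> xs ys; apply: contraTF fxy => /zs[/indepP/(_ x y xs ys)].
(* The link of the edge xy in [w]. For [s] avoiding [x] and [y], its boundary at [s] is that of [w]
   at [s] with [x] and [y] added, where [z] vanishes because [f x y]. *)
pose u s := [&& x \notin s, y \notin s & w (x |: (y |: s))].
have u0 : bdry u =1 xpred0.
  move=> s; rewrite /bdry /u; have [xs|xs] := boolP (x \in s).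
    by rewrite big1 // => a _; rewrite !inE xs orbT.
  have [ys|ys] := boolP (y \in s).
    by rewrite big1 // => a _; rewrite !inE ys orbT andbF.
  transitivity (bdry w (x |: (y |: s))); last by rewrite wz zxy // !inE eqxx ?orbT.
  rewrite /bdry [LHS](bigID (fun a => (a != x) && (a != y))) /=.
  rewrite [X in _ (+) X]big1 ?addbF => [|a /andP[_]]; last first.
    by rewrite negb_and !negbK !inE => /orP[]/eqP->; rewrite eqxx ?andbF.
  apply: eq_big => [a|a /and3P[_ ax ay]].
    by rewrite !inE !negb_or andbC -andbA.
  rewrite !inE negb_or eq_sym ax xs eq_sym negb_or ay ys /=; congr w.
  by rewrite (setUCA [set a]) (setUCA [set a]).
have [v vs vu] : exists2 v, supported g (W :\: (nbhd f x :|: nbhd f y)) k.+1 v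
    & bdry v =1 u.
  apply: aN => // s /and3P[xs ys /ws[/indepP si sW sk]].
  split; first by apply/indepP => a b As Bs; apply: si; rewrite !inE ?As ?Bs !orbT.
    apply/subsetP => a As; rewrite !inE (subsetP sW) ?inE ?As ?orbT // andbT.
    have ax : a != x by apply: contraNneq xs => <-.
    have ay : a != y by apply: contraNneq ys => <-.
    have ga b : b \in [set x; y] -> ~~ g b a.
      by rewrite inE => bxy; apply: si; rewrite !inE ?As ?orbT // orbA -!in_set1 bxy.
    have := ga x; have := ga y; rewrite !inE !eqxx orbT /g /del_edge.
    rewrite (negPf ax) (negPf ay) !andbF !andbT => /(_ isT) fy /(_ isT) fx.
    by rewrite negb_or fx fy.
  move: sk; rewrite !cardsU1 !inE negb_or xy xs ys /= !add1n => -[]; done.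
pose w0 s := w s && ~~ ((x \in s) && (y \in s)).
have wE s : w s = w0 s (+) cone x (cone y u) s.
  rewrite /w0 /cone /u !inE !eqxx /= (eq_sym y) xy /=.
  case: (boolP (x \in s)) => xs; last by rewrite andbT addbF.
  case: (boolP (y \in s)) => ys /=; last by rewrite andbT addbF.
  by rewrite andbF /= setD1K ?inE ?ys ?(eq_sym y) ?xy // setD1K.
have vN s : v s -> [/\ x \notin s & y \notin s].
  case/vs=> _ /subsetP sN _; split; apply: contraTN fxy => /sN; rewrite !inE.
    by rewrite negb_or => /andP[/andP[_ +] _]; rewrite fC.
  by rewrite negb_or => /andP[/andP[+ _] _].
(* Both x y u and x v + y v have boundary x u + y u: in the first d(u) = 0, in the second the two
   copies of [v] cancel. *)
exists (fun s => w0 s (+) (cone x v s (+) cone y v s)) => [s|s]; last first.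
  rewrite -wz (eq_bdry wE) !bdryD; congr (_ (+) _).
  have uyx t : cone y u t -> x \notin t by case/and3P=> _; rewrite !inE xy.
  rewrite !bdry_cone //; try by move=> t /vN[].
  have uy t : bdry (cone y u) t = u t.
    rewrite bdry_cone => [|r /and3P[] //]; rewrite /cone u0 andbF addbF //.
  rewrite (eq_cone x vu) (eq_cone y vu) (eq_cone x uy).
  by case: (v s) (cone x u s) (cone y u s) => [] [] [].
have fxv t a b : v t -> a \in [set x; y] -> b \in t -> ~~ f a b.
  move=> /vs[_ /subsetP tW _] + /tW; rewrite !inE negb_or.
  by case/orP=> /eqP-> /andP[/andP[]].
have fv a t : a \in [set x; y] -> v t -> indep f (a |: t).
  move=> axy vt; have ti : independent f t.
    apply/indepP/fg; first by case/vs: vt.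
    by rewrite negb_and; case/vN: vt => ->.
  apply/indepP => b c; rewrite !in_setU1 => /orP[/eqP->|bt] /orP[/eqP->|ct].
  - by rewrite fI.
  - exact: fxv vt _ _.
  - by rewrite fC; apply: fxv vt _ _.
  - exact: ti.
have cv a t : a \in [set x; y] -> cone a v t -> [/\ indep f t, t \subset W & #|t| = k.+2].
  move=> axy /andP[ta vt]; have [_ sW sk] := vs _ vt; split.
  - by rewrite -(setD1K ta) fv.
  - rewrite -(setD1K ta) subUset sub1set (subset_trans sW) ?subsetDl // andbT.
    by move: axy; rewrite !inE => /orP[]/eqP->.
  - by rewrite (cardsD1 a) ta sk.
rewrite /=; case w0s: (w0 s).
  by case/andP: w0s => /ws[si sW sk] nxy _; split=> //; apply: fg.
case cxs: (cone x v s); first by move=> _; apply: (cv x); rewrite // !inE eqxx.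
by move=> cys; apply: (cv y); rewrite // !inE eqxx orbT.
Qed.

(** * Acyclicity of sparse graphs *)

(** Quantifying over all symmetric subrelations lets the bound survive edge deletions and
    restriction to a vertex set. *)
Definition sparse m (e : rel T) :=
  forall f : rel T, symmetric f -> subrel f e -> (exists x y, f x y) ->
  exists x y, f x y /\ #|nbhd f x :|: nbhd f y| <= m.

(** Induction on the number of edges. Without an edge inside [W] the complex is a full simplex,
    filled by a cone. Otherwise [explode] applies: deletion loses an edge, and removing the
    neighborhoods costs at most [m] vertices of [W] while [k] drops by one. *)
Lemma sparse_acyclic m (e : rel T) (W : {set T}) k :
  symmetric e -> irreflexive e -> sparse m e -> m * k < #|W| -> acyclic e W k.
Proof.
have [n] := ubnP #|[set p : T * T | e p.1 p.2]|.
elim: n e W k => // n IHn e W k; rewrite ltnS => en eC eI es mk.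
pose eW : rel T := fun x y => [&& x \in W, y \in W & e x y].
have [x xW] : exists x, x \in W.
  by apply/card_gt0P; apply: leq_ltn_trans mk.
case: k mk => [|k] mk.
  move=> z zs z0; apply: (cone_fill xW) => // s /zs[_ _ /cards0_eq->].
  by apply/indepP => a b; rewrite !inE !orbF => /eqP-> /eqP->; rewrite eI.
have [/existsP[a /existsP[b eab]]|ne] := boolP [exists a, exists b, eW a b]; last first.
  move=> z zs z0; apply: (cone_fill xW) => // s /zs[_ sW _].
  apply/indepP => a b; rewrite !inE => As Bs; apply: contra ne => eab.
  apply/existsP; exists a; apply/existsP; exists b; rewrite /eW eab andbT.
  by case/orP: As => [/eqP->|/(subsetP sW)->];
    case/orP: Bs => [/eqP->|/(subsetP sW)->]; rewrite ?xW.
have eWC : symmetric eW by move=> u v; rewrite /eW eC andbCA.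
have eWe : subrel eW e by move=> u v /and3P[].
(* Passing to [eW] puts the edge inside [W] and counts only neighbors in [W]. *)
have [u [v [/and3P[uW vW euv] uvm]]] :
    exists x y, eW x y /\ #|nbhd eW x :|: nbhd eW y| <= m.
  by apply: es => //; exists a, b.
have dC : symmetric (del_edge e u v).
  by move=> c d; rewrite /del_edge eC [in RHS]orbC
    [X in ~~ (X || _)]andbC [X in ~~ (_ || X)]andbC.
have dI : irreflexive (del_edge e u v) by move=> c; rewrite /del_edge eI.
have ds : sparse m (del_edge e u v).
  by move=> f fC fe; apply: es => // c d /fe/andP[].
have dn : #|[set p : T * T | del_edge e u v p.1 p.2]| < n.
  apply: leq_trans en; apply: proper_card; apply/properP; split.
    by apply/subsetP => p; rewrite !inE => /andP[].
  by exists (u, v); rewrite !inE //= /del_edge !eqxx andbF.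
apply: (explode eC eI euv) => //; first exact: IHn.
apply: IHn => //; rewrite -(ltn_add2l m) -mulnS (leq_trans mk) //.
rewrite -(cardsID (nbhd e u :|: nbhd e v) W) leq_add2r (leq_trans _ uvm) //.
apply: subset_leq_card; apply/subsetP => c; rewrite !inE /eW uW vW /=.
by case/andP=> ->.
Qed.

End Chains.

(** * Rainbow sets and Sperner parity *)

Section Rainbow.
Variables (T I : finType) (c : T -> option I).
Implicit Types (J : {set I}) (s t : {set T}).

Definition parts J := [set x | if c x is Some i then i \in J else false].

Definition rainbow J s :=
  [forall i, #|[set x in s | c x == Some i]| == (i \in J)].

Lemma card_color_setD1 s x i : x \in s ->
  #|[set y in s | c y == Some i]| =
  (c x == Some i) + #|[set y in s :\ x | c y == Some i]|.
Proof.
move=> xs; rewrite (cardsD1 x) !inE xs /=; congr (_ + _).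
by apply: eq_card => y; rewrite !inE andbA.
Qed.

(** If removing some [x] of color [j] leaves a rainbow set for [J :\ i], the vertices whose removal
    does so are exactly those of color [j]: one if j = i, in which case [s] is rainbow, and two
    otherwise. *)
Lemma odd_rainbow_faces J i s : i \in J -> s \subset parts J ->
  odd #|[pred x | (x \in s) && rainbow (J :\ i) (s :\ x)]| = rainbow J s.
Proof.
move=> iJ sJ.
have colored x : x \in s -> exists2 j, c x = Some j & j \in J.
  by move=> /(subsetP sJ); rewrite inE; case: (c x) => // j jJ; exists j.
have [x /andP[xs xJ]|no] :=
    pickP [pred x | (x \in s) && rainbow (J :\ i) (s :\ x)]; last first.
  rewrite eq_card0 //; apply/esym/negP => /forallP sr.
  have /card_gt0P[x] : 0 < #|[set x in s | c x == Some i]|.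
    by rewrite (eqP (sr i)) iJ.
  rewrite inE => /andP[xs cx]; have := no x; rewrite /= xs /=.
  move=> /negP; apply; apply/forallP => j; have := sr j.
  rewrite (card_color_setD1 _ xs) (eqP cx) !inE (inj_eq (@Some_inj _)).
  by case: (eqVneq i j) => [<-|]; rewrite ?iJ.
have [j cx jJ] := colored _ xs.
have faceE y : y \in s -> rainbow (J :\ i) (s :\ y) = (c y == Some j).
  move=> ys; have [l cy lJ] := colored _ ys; move: xJ => /forallP xJ.
  apply/forallP/eqP => [yJ|cyj k].
    have := card_color_setD1 j xs; rewrite (card_color_setD1 j ys) cx eqxx.
    by rewrite (eqP (xJ j)) (eqP (yJ j)) => /eqP; rewrite eqn_add2r;
      case: (c y =P Some j).
  have := card_color_setD1 k xs; rewrite (card_color_setD1 k ys) cx cyj.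
  by move=> /eqP; rewrite eqn_add2l (eqP (xJ k)).
rewrite (_ : #|_| = #|[set y in s | c y == Some j]|); last first.
  by apply: eq_card => y; rewrite !inE; case ys: (y \in s); rewrite //= faceE.
have sE k : #|[set y in s | c y == Some k]| = (j == k) + ((k != i) && (k \in J)).
  rewrite (card_color_setD1 _ xs) (eqP (forallP xJ k)) cx !inE.
  by rewrite (inj_eq (@Some_inj _)).
rewrite sE eqxx jJ andbT; apply/idP/forallP => [|/(_ j)]; last first.
  by rewrite sE eqxx jJ andbT; case: (j != i).
rewrite oddD !oddb addTb negbK => /eqP ji k.
by rewrite sE ji (eq_sym i); case: (k =P i) => [->|]; rewrite ?iJ.
Qed.

(** Double counting, mod 2, of the pairs formed by a set of [ch] and a rainbow face of it. *)
Lemma xor_rainbow_bdry J i (ch : {set T} -> bool) :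
  i \in J -> (forall s, ch s -> s \subset parts J) ->
  \xor_(s | rainbow (J :\ i) s) bdry ch s = \xor_(s | rainbow J s) ch s.
Proof.
move=> iJ chJ; rewrite /bdry (exchange_big_dep xpredT) //=.
transitivity (\big[addb/false]_(x : T)
    \big[addb/false]_(s : {set T} | (x \in s) && rainbow (J :\ i) (s :\ x)) ch s).
  apply: eq_bigr => x _.
  rewrite [RHS](reindex_onto (fun s => x |: s) (fun s => s :\ x)) /=; last first.
    by move=> s /andP[xs _]; rewrite setD1K.
  apply: eq_big => // s; rewrite setU11 /=.
  have [xs|xs] := boolP (x \in s); last by rewrite setU1K // eqxx !andbT.
  rewrite andbF; apply/esym/negbTE; rewrite negb_and orbC.
  by apply/orP; left; apply: contraTneq xs => <-; rewrite !inE eqxx.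
rewrite (exchange_big_dep xpredT) //= [RHS]big_mkcond; apply: eq_bigr => s _.
rewrite xor_const; case chs: (ch s); last by rewrite andbF if_same.
by rewrite andbT (odd_rainbow_faces iJ (chJ _ chs)); case: rainbow.
Qed.

Lemma leq_card_parts m J :
  (forall i, m <= #|[set x | c x == Some i]|) -> m * #|J| <= #|parts J|.
Proof.
move=> cm; rewrite mulnC -sum_nat_const.
apply: leq_trans (leq_sum _ (fun i _ => cm i)) _.
rewrite (eq_bigr (fun i => \sum_x (c x == Some i : nat))); last first.
  by move=> i _; rewrite -sum1dep_card big_mkcond; apply: eq_bigr => x _; case: eqP.
rewrite exchange_big /= -sum1_card [X in _ <= X]big_mkcond; apply: leq_sum => x _.
rewrite inE; case cx: (c x) => [i|]; last by rewrite big1.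
case iJ: (i \in J).
  rewrite (bigD1 i) //= eqxx big1 ?addn0 // => j /andP[_ ji].
  by rewrite (inj_eq (@Some_inj _)) eq_sym (negPf ji).
rewrite big1 // => j jJ; rewrite (inj_eq (@Some_inj _)).
by case: eqP jJ => // <-; rewrite iJ.
Qed.

(** [F] is a chain map from the full simplex on [I] to the independence complex, carrying the face
    [J] into [parts J]. It is built by increasing size of [J]: the sum of the [F (J :\ i)] is a
    cycle because each [F (J :\: [set i; j])] occurs twice in its boundary, so acyclicity provides a
    filling. *)
Lemma parts_fill (e : rel T) :
  (forall J k, k < #|J| -> acyclic e (parts J) k) ->
  exists F : {set I} -> {set T} -> bool,
    F set0 =1 pred1 set0 /\ forall J,
    supported e (parts J) #|J| (F J) /\
    bdry (F J) =1 fun s => \xor_(i in J) F (J :\ i) s.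
Proof.
move=> acyc.
suff [F [F0 FP]] : exists F : {set I} -> {set T} -> bool,
    F set0 =1 pred1 set0 /\ forall J, #|J| <= #|I| ->
    supported e (parts J) #|J| (F J) /\
    bdry (F J) =1 fun s => \xor_(i in J) F (J :\ i) s.
  by exists F; split=> // J; apply: FP; apply: max_card.
elim: #|I| => [|n [F [F0 FP]]].
  exists (fun=> pred1 set0); split=> // J; rewrite leqn0 cards_eq0 => /eqP->.
  split=> [s /eqP->|s].
    by rewrite sub0set !cards0; split=> //; apply/indepP => x y; rewrite inE.
  by rewrite big_set0 /bdry big1 // => x _; apply/eqP/setP => /(_ x); rewrite !inE eqxx.
have : forall J, exists G : {set T} -> bool, (#|J| <= n -> G = F J) /\
    (#|J| = n.+1 -> supported e (parts J) #|J| G /\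
    bdry G =1 fun s => \xor_(i in J) F (J :\ i) s).
  move=> J; have [Jn|nJ] := leqP #|J| n.
    by exists (F J); split=> // Jn1; rewrite Jn1 ltnn in Jn.
  have [Jn|Jn] := eqVneq #|J| n.+1; last first.
    by exists (F J); split => [|/eqP]; rewrite ?(negPf Jn) // leqNgt nJ.
  have JD i : i \in J -> #|J :\ i| = n.
    by move=> iJ; move: Jn; rewrite (cardsD1 i) iJ add1n => -[].
  have [||w ws wb] := acyc J n nJ (fun s => \xor_(i in J) F (J :\ i) s).
  - move=> s /= Fs; have [i iJ Fi] : exists2 i, i \in J & F (J :\ i) s.
      apply/exists_inP; apply: contraTT Fs => /exists_inPn no.
      by rewrite big1 // => i /no/negbTE.
    have [|/(_ _ Fi)[si sJ sn] _] := FP (J :\ i); first by rewrite JD.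
    split=> //; last by rewrite sn JD.
    apply: subset_trans sJ _; apply/subsetP => x; rewrite !inE.
    by case: (c x) => // j; rewrite !inE => /andP[].
  - move=> s; rewrite /bdry exchange_big /=.
    rewrite -[RHS](@xor_sym0 _ J (fun i j => F (J :\: [set i; j]) s)); last first.
      by move=> i j; rewrite setUC.
    apply: eq_bigr => i iJ; have [|_ /(_ s)] := FP (J :\ i); first by rewrite JD.
    by rewrite /bdry => ->; apply: eq_bigr => j _; rewrite setDDl.
  by exists w; split=> // _; split=> //; rewrite Jn.
case/fin_all_exists => G GP; exists G.
have GF J : #|J| <= n -> G J = F J by case: (GP J).
split=> [|J]; first by rewrite GF ?cards0.
rewrite leq_eqVlt => /predU1P[Jn|]; last first.
  rewrite ltnS => Jn; rewrite GF //; have [FS FB] := FP J Jn; split=> // s.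
  rewrite FB; apply: eq_bigr => i iJ; rewrite GF // (leq_trans _ Jn) //.
  by rewrite subset_leq_card // subD1set.
have [_ /(_ Jn)[GS GB]] := GP J; split=> // s; rewrite GB.
apply: eq_bigr => i iJ; rewrite GF //.
by move: Jn; rewrite (cardsD1 i) iJ add1n => -[->].
Qed.

(* A Sperner-type parity argument: the fillings of all the [parts J] form the
   image of a subdivided simplex, whose number of rainbow facets is odd. *)
Theorem sparse_transversal m (e : rel T) : 0 < m -> symmetric e ->
  irreflexive e -> sparse m e -> (forall i, m <= #|[set x | c x == Some i]|) ->
  exists R, [/\ independent e R, R \subset parts setT &
    forall i, #|[set x in R | c x == Some i]| = 1].
Proof.
move=> m0 eC eI es cm; have [J k kJ|F [F0 FP]] := @parts_fill e.
  apply: sparse_acyclic es _ => //.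
  by apply: leq_trans (leq_card_parts _ cm); rewrite ltn_mul2l m0.
have rF J : \xor_(s | rainbow J s) F J s.
  have [n] := ubnP #|J|; elim: n J => // n IHn J; rewrite ltnS => Jn.
  have [->|[i iJ]] := set_0Vmem J.
    rewrite (bigD1 set0) /=; last first.
      by apply/forallP => i; rewrite inE; apply/eqP/eq_card0 => x; rewrite !inE.
    by rewrite F0 /= eqxx big1 // => s /andP[_ s0]; rewrite F0 /= (negPf s0).
  have [FS FB] := FP J.
  rewrite -(xor_rainbow_bdry iJ) => [|s /FS[] //].
  rewrite (_ : \xor_(s | _) _ = \xor_(s | rainbow (J :\ i) s) F (J :\ i) s).
    by apply: IHn; apply: leq_trans Jn; rewrite (cardsD1 i J) iJ.
  (* Only the term of [i] survives: for j != i, the sets of [F (J :\ j)] lack the color [j], which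
     [s] must contain. *)
  apply: eq_bigr => s sr; rewrite FB (bigD1 i) //= big1 ?addbF // => j /andP[jJ ji].
  apply/negP => /(proj1 (FP _))[_ /subsetP sJ _].
  have /card_gt0P[x] : 0 < #|[set x in s | c x == Some j]|.
    by rewrite (eqP (forallP sr j)) !inE ji jJ.
  by rewrite inE => /andP[/sJ]; rewrite inE => + /eqP cx; rewrite cx !inE eqxx.
have /existsP[R /andP[Rr FR]] : [exists R, rainbow setT R && F setT R].
  apply: contraTT (rF setT) => /existsPn no; rewrite big1 // => s sr.
  by have := no s; rewrite sr => /negbTE.
have [Ri Rp _] := proj1 (FP setT) _ FR.
exists R; split=> // [|i]; first exact/indepP.
by rewrite (eqP (forallP Rr i)) inE.
Qed.

End Rainbow.

(** * Independent representatives in sparse graphs *)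

Lemma sparse_ISR m (T : finType) (e : rel T) n (V : 'I_n -> {set T}) :
  0 < m -> symmetric e -> irreflexive e -> sparse m e ->
  (forall i j, i != j -> [disjoint V i & V j]) -> (forall i, m <= #|V i|) ->
  exists R, is_ISR e V R.
Proof.
(* A vertex is colored by the index of its part, or [None] outside all parts; disjointness makes the
   color unambiguous. *)
move=> m0 eC eI es dV cV; pose c x := [pick i | x \in V i].
have cE x i : (c x == Some i) = (x \in V i).
  rewrite /c; case: pickP => [j xj|->] //; rewrite (inj_eq (@Some_inj _)).
  have [<-|/dV dji] := eqVneq j i; first by rewrite xj.
  by rewrite (disjointFr dji).
have cardE (R : {set T}) i : #|[set x in R | c x == Some i]| = #|R :&: V i|.
  by apply: eq_card => x; rewrite !inE cE.
have [i|R [Ri RV R1]] := @sparse_transversal _ _ c m e m0 eC eI es.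
  rewrite (leq_trans (cV i)) // subset_leq_card //.
  by apply/subsetP => x; rewrite !inE cE.
exists R; split=> //; split=> [|i]; last by rewrite -cardE.
apply/subsetP => x /(subsetP RV); rewrite inE; case cx: (c x) => [i|] // _.
by apply/bigcupP; exists i; rewrite // -cE cx.
Qed.

Lemma sparse_max_degree d (T : finType) (e : rel T) :
  max_degree_le e d -> sparse (d + d) e.
Proof.
move=> ed f _ fe [x [y fxy]]; exists x, y; split=> //.
have fd z : #|nbhd f z| <= d.
  by apply: leq_trans (ed z); apply: subset_leq_card;
    apply/subsetP => a; rewrite !inE => /fe.
by rewrite (leq_trans (leq_card_setU _ _)) // leq_add.
Qed.

(** * An ISR meeting every large component *)

Section TwoDisjoint.
Variables (T : finType) (e : rel T) (n : nat) (V : 'I_n -> {set T}).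
Hypotheses (eC : symmetric e) (eI : irreflexive e).
Hypothesis dV : forall i j, i != j -> [disjoint V i & V j].

Let W := \bigcup_(i < n) V i.
Let eW : rel T := fun x y => [&& x \in W, y \in W & e x y].
Let comp x := [set y | connect eW x y].
Let eW_sym : connect_sym eW.
Proof. by apply: sym_connect_sym => x y; rewrite /eW eC andbCA. Qed.

Lemma V_inj x i j : x \in V i -> x \in V j -> i = j.
Proof.
by move=> xi xj; apply/eqP; apply: contraT => /dV/pred0P/(_ x); rewrite /= xi xj.
Qed.

(** An edge from [v] to [R] would lie inside [W] and so put a vertex of [R] in the component of
    [v]. *)
Lemma swap_ISR R v i r : is_ISR e V R -> [disjoint comp v & R] ->
  v \in V i -> r \in R -> r \in V i -> is_ISR e V (v |: R :\ r).
Proof.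
move=> [Ri [RW R1]] vR vi rR ri.
have inW x j : x \in V j -> x \in W by move=> xj; apply/bigcupP; exists j.
have ev a : a \in R -> ~~ e v a.
  move=> aR; apply: contraT => /negPn eva.
  suff /(disjointFr vR) : a \in comp v by rewrite aR.
  by rewrite inE connect1 // /eW (inW v i) // (subsetP RW).
have vnR : v \notin R.
  by rewrite (disjointFr vR) // inE connect0.
split; [move=> a b | split=> [|j]].
- rewrite !inE => /orP[/eqP->|/andP[_ aR]] /orP[/eqP->|/andP[_ bR]].
  + by rewrite eI.
  + exact: ev.
  + by rewrite eC ev.
  + exact: Ri.
- by rewrite subUset sub1set (inW v i) // (subset_trans _ RW) // subD1set.
have [->|ji] := eqVneq j i.
  rewrite (_ : _ :&: _ = [set v]) ?cards1 //; apply/setP => a; rewrite !inE.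
  case: (eqVneq a v) => [->|_] /=; first by rewrite vi.
  apply/negP => /andP[/andP[ar aR] ai]; move: (R1 i) => /eqP/cards1P[b Rb].
  move/setP: Rb => Rb; have := Rb a; have := Rb r; rewrite !inE aR ai rR ri.
  by move=> /esym/eqP rb /esym/eqP ab; rewrite rb ab eqxx in ar.
rewrite -(R1 j); apply: eq_card => a; rewrite !inE.
have [aj|] := boolP (a \in V j); rewrite ?andbF // !andbT.
have -> : a == v = false.
  by apply: contraNF ji => /eqP av; rewrite (@V_inj v j i) // -av.
have -> // : a != r by apply: contraNneq ji => ar; rewrite (@V_inj r j i) // -ar.
Qed.

(** The large components serve as parts and [q] makes each [V i] a clique. The neighborhoods of both
    ends of an edge of [q] stay in one [V i], whence the bound 4. *)
Lemma big_comp_SDR : (forall i, #|V i| = 4) ->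
  exists S : {set T}, [/\ S \subset W,
    forall i x y, x \in S -> y \in S -> x \in V i -> y \in V i -> x = y &
    forall x, x \in W -> 3 < #|comp x| -> ~~ [disjoint comp x & S]].
Proof.
move=> V4; pose P := [set C in [set comp x | x in W] | 3 < #|C|].
pose q : rel T := fun x y => (x != y) && [exists i, (x \in V i) && (y \in V i)].
have qC : symmetric q.
  by move=> x y; rewrite /q eq_sym; under eq_existsb do rewrite andbC.
have qI : irreflexive q by move=> x; rewrite /q eqxx.
have qs : sparse 4 q.
  move=> f _ fq [x [y fxy]]; exists x, y; split=> //.
  have /andP[_ /existsP[i /andP[xi yi]]] := fq _ _ fxy.
  rewrite -(V4 i); apply: subset_leq_card; apply/subsetP => a.
  by rewrite !inE => /orP[]/fq/andP[_ /existsP[j /andP[/V_inj jE aj]]];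
    rewrite -(jE i).
have [k l kl|k|S [Si [SP S1]]] := @sparse_ISR 4 T q #|P| enum_val isT qC qI qs.
- have := enum_valP k; have := enum_valP l; rewrite !inE.
  move=> /andP[/imsetP[y _ ly] _] /andP[/imsetP[x _ kx] _].
  apply: contraNT kl => /pred0Pn[a /= /andP[]].
  rewrite ly kx !inE => xa ya; rewrite -(inj_eq enum_val_inj) ly kx.
  apply/eqP/setP => b; rewrite !inE (same_connect eW_sym xa).
  by rewrite (same_connect eW_sym ya).
- by have := enum_valP k; rewrite inE => /andP[].
exists S; split=> [|i x y xS yS xi yi|x xW x3].
- apply/subsetP => a /(subsetP SP)/bigcupP[k _].
  have := enum_valP k; rewrite inE => /andP[/imsetP[x xW ->] _]; rewrite inE => xa.
  have cW : closed eW (mem W) by apply: intro_closed => // u v /and3P[].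
  by rewrite -[a \in W](closed_connect cW xa).
- apply/eqP; have := Si x y xS yS; rewrite negb_and negbK => /orP[//|/existsPn/(_ i)].
  by rewrite xi yi.
have xP : comp x \in P by rewrite inE x3 andbT; apply/imsetP; exists x.
have /eqP/cards1P[a /setP/(_ a)] := S1 (enum_rank_in xP (comp x)).
rewrite enum_rankK_in // in_set1 eqxx inE => /andP[aS ax].
by apply/pred0Pn; exists a; rewrite /= ax.
Qed.

(** Each swap decreases [#|S :\: R|]: [v] enters [R], and the vertex [r] it replaces is not in [S],
    since [v] is the only vertex of [S] in [V i]. *)
Lemma hitting_ISR : max_degree_le e 2 -> (forall i, #|V i| = 4) ->
  exists2 R, is_ISR e V R &
    forall x, x \in W -> 3 < #|comp x| -> ~~ [disjoint comp x & R].
Proof.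
move=> e2 V4; have [S [SW Si SP]] := big_comp_SDR V4.
have [|R0 R0i] := @sparse_ISR 4 T e n V isT eC eI (sparse_max_degree e2) dV.
  by move=> i; rewrite V4.
have [k] := ubnP #|S :\: R0|; elim: k R0 R0i => // k IHk R Ri; rewrite ltnS => Rk.
have [/existsP[x /and3P[xW x3 xR]]|hit] :=
    boolP [exists x, [&& x \in W, 3 < #|comp x| & [disjoint comp x & R]]]; last first.
  exists R => // x xW x3; apply: contra hit => xR; apply/existsP; exists x.
  by rewrite xW x3.
have /pred0Pn[v /= /andP[xv vS]] := SP x xW x3.
have /bigcupP[i _ vi] := subsetP SW v vS.
have vR : [disjoint comp v & R].
  rewrite (eq_disjoint (B := comp x)) // => a; rewrite !inE.
  by rewrite inE in xv; rewrite (same_connect eW_sym xv).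
have vnR : v \notin R by rewrite (disjointFr vR) // inE connect0.
have /eqP/cards1P[r /setP/(_ r)] := proj2 (proj2 Ri) i.
rewrite in_set1 eqxx inE => /andP[rR ri].
apply: (IHk _ (swap_ISR Ri vR vi rR ri)); apply: leq_trans Rk.
apply: proper_card; apply/properP; split; last first.
  by exists v; rewrite !inE ?vS ?vnR // eqxx.
apply/subsetP => a; rewrite !inE !negb_or negb_and negbK => /andP[/andP[av arR] aS].
rewrite aS andbT; case/orP: arR => // /eqP ar; subst a.
by rewrite (Si i r v) // eqxx in av.
Qed.

(* An edge relation in which every edge has four vertices in its neighborhood
   is 2-regular on its support, hence fills components of [eW], which have size
   at least four and thus meet R. *)
Lemma sparse_hitting (R : {set T}) : max_degree_le e 2 ->
  (forall x, x \in W -> 3 < #|comp x| -> ~~ [disjoint comp x & R]) ->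
  sparse 3 (fun x y => [&& eW x y, x \notin R & y \notin R]).
Proof.
move=> e2 hit f fC fe [x0 [y0 fxy0]].
have [/existsP[x /existsP[y /andP[fxy xy3]]]|big] :=
    boolP [exists x, exists y, f x y && (#|nbhd f x :|: nbhd f y| <= 3)].
  by exists x, y.
have f4 x y : f x y -> 3 < #|nbhd f x :|: nbhd f y|.
  move=> fxy; rewrite ltnNge; apply: contra big => xy3.
  by apply/existsP; exists x; apply/existsP; exists y; rewrite fxy.
have fsub x : nbhd f x \subset nbhd e x.
  by apply/subsetP => y; rewrite !inE => /fe/and3P[/and3P[]].
have f2 x : #|nbhd f x| <= 2 by apply: leq_trans (e2 x); apply: subset_leq_card.
(* Two neighborhoods of size at most 2 whose union has at least 4 vertices both have size 2, so [f]
   keeps every edge of [e] at [x]. *)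
have full x y : f x y -> nbhd f x = nbhd e x.
  move=> fxy; apply/eqP; rewrite eqEcard fsub (leq_trans (e2 x)) //.
  have := leq_trans (f4 x y fxy) (leq_card_setU _ _).
  by move=> /leq_trans/(_ (leq_add (leqnn _) (f2 y))); rewrite addn2 !ltnS.
have fC' : closed eW [pred x | [exists y, f x y]].
  apply: intro_closed => // x y /and3P[_ _ exy] /existsP[z fxz].
  apply/existsP; exists x; rewrite fC.
  by have /setP/(_ y) := full _ _ fxz; rewrite !inE exy.
have fx0 y : connect eW x0 y -> exists z, f y z.
  move=> /(closed_connect fC'); rewrite !inE => H; apply/existsP; rewrite -H.
  by apply/existsP; exists y0.
have /and3P[/and3P[x0W y0W exy0] _ _] := fe _ _ fxy0.
have /pred0Pn[a /andP[/= ]] : ~~ [disjoint comp x0 & R].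
  apply: hit => //; apply: leq_trans (f4 _ _ fxy0) _; apply: subset_leq_card.
  apply/subsetP => a; rewrite !inE => /orP[]/fe/andP[/connect1 // ya _].
  by apply: connect_trans ya; apply: connect1; apply/and3P.
by rewrite inE => /fx0[z /fe/and3P[_ /negPf->]].
Qed.

End TwoDisjoint.

(** * A second ISR disjoint from the first *)

Theorem theorem1p7 (T : finType) (e : rel T) (n : nat) (V : 'I_n -> {set T}) :
  simple_graph e -> max_degree_le e 2 ->
  (forall i j : 'I_n, i != j -> [disjoint V i & V j]) ->
  (forall i : 'I_n, #|V i| = 4) ->
  exists R1 R2 : {set T},
    [/\ is_ISR e V R1, is_ISR e V R2 & [disjoint R1 & R2]].
Proof.
move=> [eC eI] e2 dV V4.
have [R1 R1i /(sparse_hitting eC e2)] := hitting_ISR eC eI dV e2 V4.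
set f : rel T := fun x y => _ => fs.
have fC : symmetric f.
  by move=> x y; rewrite /f eC andbCA -!andbA; do !bool_congr.
have fI : irreflexive f by move=> x; rewrite /f eI !andbF.
have [i j ij|i|R2 [R2i [R2W R21]]] :=
    @sparse_ISR 3 T f n (fun i => V i :\: R1) isT fC fI fs.
- by apply: disjointWl (subsetDl _ _) (disjointWr (subsetDl _ _) (dV i j ij)).
- by have := cardsID R1 (V i); rewrite V4 setIC (proj2 (proj2 R1i)) add1n => -[->].
have inR2 x : x \in R2 -> x \notin R1 /\ x \in \bigcup_i V i.
  move=> /(subsetP R2W)/bigcupP[i _]; rewrite inE => /andP[xR xi].
  by split=> //; apply/bigcupP; exists i.
exists R1, R2; split=> //; last first.
  by rewrite disjoint_sym disjoint_subset; apply/subsetP => x /inR2[].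
split; [|split=> [|i]].
(* On vertices of the union of the parts outside [R1], [f] agrees with [e], so independence carries
   back to [e]. *)
- move=> x y xR yR; have := R2i x y xR yR; rewrite /f.
  by have [-> ->] := inR2 x xR; have [-> ->] := inR2 y yR; rewrite /= !andbT.
- by apply/subsetP => x /inR2[].
rewrite -(R21 i); apply: eq_card => x; rewrite !inE.
by case xR: (x \in R2) => //=; have [->] := inR2 x xR.
Qed.
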